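(* Let $\gamma_n$ be the domination number of the Sierpiński gasket graph $S_n$, and for $k\in\{0,1,2,3\}$ let $\gamma_n^k$ be the minimum number of vertices needed, in addition to $k$ corner vertices of $S_n$, to dominate $S_n'$ (the set of non-corner vertices of $S_n$). Then for every integer $n\ge4$, $$\gamma_n=3\,\gamma_{n-1},$$ and $$\gamma_n^k\ge \gamma_n\quad\text{for } k=0,1,\qquad\qquad \gamma_n^k\ge\gamma_n-1\quad\text{for } k=2,3.$$
   Context: The Sierpiński gasket graph $S_n$ ($n\ge1$) is the finite simple graph whose vertices are the intersection points of the line segments in the $n$-th finite stage of the Sierpiński gasket and whose edges are the segments joining consecutive such points. Equivalently, it is defined recursively as follows. $S_1$ is a triangle ($K_3$), with its three vertices designated as the top, left and right corner vertices. For $n\ge1$, $S_{n+1}$ is obtained from three disjoint copies $S_{n+1,T}$ (top), $S_{n+1,L}$ (bottom left), $S_{n+1,R}$ (bottom right) of $S_n$ by identifying the left corner of $S_{n+1,T}$ with the top corner of $S_{n+1,L}$, the right corner of $S_{n+1,T}$ with the top corner of $S_{n+1,R}$, and the right corner of $S_{n+1,L}$ with the left corner of $S_{n+1,R}$. The top, left and right corners $v_T,v_L,v_R$ of $S_{n+1}$ are the top corner of $S_{n+1,T}$, the left corner of $S_{n+1,L}$ and the right corner of $S_{n+1,R}$, respectively; the corner vertices are exactly the degree-two vertices of the graph. A vertex dominates itself and all its neighbours; the domination number is the minimum size of a set of vertices that together dominate all vertices. Put $S_n'=S_n\setminus\{v_T,v_L,v_R\}$. Precisely, $\gamma_n^k$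 is the minimum of $|D|$ over sets $D$ of vertices of $S_n'$ such that, for a set $K\subseteq\{v_T,v_L,v_R\}$ with $|K|=k$, every vertex of $S_n'$ belongs to $D$ or is adjacent (in $S_n$) to a vertex of $D\cup K$. By symmetry this does not depend on the choice of $K$. Corner vertices themselves need not be dominated. *)

(* Defs.v *)
From HB Require Import structures.
From mathcomp Require Import all_boot.

Set Implicit Arguments.
Unset Strict Implicit.
Unset Printing Implicit Defensive.

Local Open Scope quotient_scope.

(* Finite simple graphs with three distinct designated corners; the corner
   indices 0, 1, 2 : 'I_3 stand for top, left and right. *)
Record graph3 := Graph3 {
  vertex :> finType;
  adj : rel vertex;
  corner : 'I_3 -> vertex;
  adj_sym : symmetric adj;
  adj_irr : irreflexive adj;
  corner_inj : injective corner }.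

Fact triangle_sym : symmetric (fun i j : 'I_3 => i != j).
Proof. by move=> i j; rewrite eq_sym. Qed.

Fact triangle_irr : irreflexive (fun i j : 'I_3 => i != j).
Proof. by move=> i; rewrite eqxx. Qed.

Definition triangle : graph3 :=
  @Graph3 'I_3 (fun i j => i != j) id triangle_sym triangle_irr (@inj_id _).

Section Glue.
Variable G : graph3.

(* The pair (i, x) is the vertex x of the i-th copy of G (0 top, 1 bottom left,
   2 bottom right).  For i != j, corner j of copy i is identified with corner i
   of copy j; for i = j the second disjunct forces x = y. *)
Definition glue_eq (u v : 'I_3 * G) : bool :=
  (u == v) || ((u.2 == corner G v.1) && (v.2 == corner G u.1)).

Fact glue_eq_refl : reflexive glue_eq.
Proof. by move=> u; rewrite /glue_eq eqxx. Qed.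

Fact glue_eq_sym : symmetric glue_eq.
Proof. by move=> u v; rewrite /glue_eq eq_sym andbC. Qed.

Fact glue_eq_trans : transitive glue_eq.
Proof.
move=> [j y] [i x] [k z]; rewrite /glue_eq /=.
case/predU1P=> [[-> ->] //|/andP[/eqP-> /eqP->]].
case/predU1P=> [[<- <-]|/andP[/eqP/(@corner_inj G)-> /eqP->]].
  by rewrite !eqxx orbT.
by rewrite eqxx.
Qed.

Canonical glue_equiv := EquivRel glue_eq glue_eq_refl glue_eq_sym glue_eq_trans.

Definition glue_vertex : finType := quot_type {eq_quot glue_equiv}.

Definition glue_pi (u : 'I_3 * G) : glue_vertex := \pi_{eq_quot glue_equiv} u.

Lemma glue_piE u v : (glue_pi u == glue_pi v) = glue_eq u v.
Proof.
by apply/eqP/idP=> /(eqmodP glue_equiv).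
Qed.

Definition glue_adj (p q : glue_vertex) : bool :=
  [exists u, exists v, [&& glue_pi u == p, glue_pi v == q,
                           u.1 == v.1 & adj u.2 v.2]].

Definition glue_corner (i : 'I_3) : glue_vertex := glue_pi (i, corner G i).

Fact glue_adj_sym : symmetric glue_adj.
Proof.
suff sub p q : glue_adj p q -> glue_adj q p by move=> p q; apply/idP/idP=> /sub.
move=> /existsP[u /existsP[v /and4P[pu qv uv a]]].
apply/existsP; exists v; apply/existsP; exists u.
by rewrite pu qv eq_sym uv adj_sym.
Qed.

Fact glue_adj_irr : irreflexive glue_adj.
Proof.
move=> p; apply/negbTE/negP=> /existsP[[i x] /existsP[[j y] /and4P[/eqP<-]]].
rewrite eq_sym glue_piE /glue_eq /= => h /eqP ij; move: h; rewrite -{j}ij.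
by case/predU1P=> [[->]|/andP[/eqP-> /eqP->]]; rewrite adj_irr.
Qed.

Fact glue_corner_inj : injective glue_corner.
Proof.
move=> i j /eqP; rewrite glue_piE /glue_eq /=.
by case/predU1P=> [[]|/andP[/eqP/(@corner_inj G)]].
Qed.

Definition glue : graph3 :=
  Graph3 glue_adj_sym glue_adj_irr glue_corner_inj.

End Glue.

(* S_1 is the triangle and S_{n+1} = glue S_n for n >= 1; the value at 0 is a
   dummy one. *)
Definition sierpinski (n : nat) : graph3 := iter n.-1 glue triangle.

Section Domination.
Variable G : graph3.

Definition dominating (D : {set G}) : bool :=
  [forall v, (v \in D) || [exists u in D, adj v u]].

Definition domination_number : nat :=
  #|[arg min_(D < [set: G] | dominating D) #|D| ]|.

Definition corners : {set G} := [set corner G i | i : 'I_3].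

Definition dominates_interior (K D : {set G}) : bool :=
  [forall v in ~: corners, (v \in D) || [exists u in D :|: K, adj v u]].

Definition completes_corners (k : nat) (D : {set G}) : bool :=
  (D \subset ~: corners) &&
  [exists K : {set G},
     [&& K \subset corners, #|K| == k & dominates_interior K D]].

(* Meaningful for k <= 3: the default ~: corners of the arg min is then
   itself admissible. *)
Definition corner_domination_number (k : nat) : nat :=
  #|[arg min_(D < ~: corners | completes_corners k D) #|D| ]|.

Lemma dominatingT : dominating [set: G].
Proof. by apply/forallP=> v; rewrite inE. Qed.

Lemma card_corners : #|corners| = 3.
Proof. by rewrite card_imset ?card_ord //; apply: corner_inj. Qed.

Lemma completes_cornersC k : k <= 3 -> completes_corners k (~: corners).
Proof.
rewrite /completes_corners subxx /= -card_corners => kle3.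
apply/existsP; exists [set x in take k (enum corners)]; apply/and3P; split.
- by apply/subsetP=> x; rewrite inE => /mem_take; rewrite mem_enum.
- rewrite cardsE (card_uniqP _) ?take_uniq ?enum_uniq //.
  by rewrite size_takel // -cardE.
- by apply/forall_inP=> v ->.
Qed.

End Domination.

Definition gamma (n : nat) : nat := domination_number (sierpinski n).

Definition gammak (n k : nat) : nat :=
  corner_domination_number (sierpinski n) k.

(* Main.v *)
(** For a vertex set D let the weight of D be 2|D| minus the number of corners
    in D, i.e. interior vertices count twice and corners once.  A corner of a
    copy becomes a corner of the glued graph or one half of an identified pair,
    so the weight is additive under gluing.  If D dominates the interior of S_2,
    two of its three triangles cannot both miss D, because their common vertex
    would not be dominated; so the weight is at least 2, and by additivity at
    least 2 * 3^(n-2) in S_n.  All the lower bounds follow.  Conversely, the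
    union of dominating sets of the copies is dominating, and S_3 has a
    dominating set of size 3, whence gamma_n = 3^(n-2) for n >= 3. *)

Require Import Defs.
From mathcomp Require Import all_boot.
From mathcomp Require Import zify.

Set Implicit Arguments.
Unset Strict Implicit.
Unset Printing Implicit Defensive.

(** * Domination and weight in a single graph *)

Section Weight.
Variable G : graph3.
Implicit Types (D K : {set G}) (v : G).

Definition dominated D v := (v \in D) || [exists u in D, adj v u].

(** [D] may contain corners, so a set [K] of given corners can be absorbed into it. *)
Definition interior_dominating D :=
  forall v, v \notin corners G -> dominated D v.

Definition vertex_weight v := (v \notin corners G).+1.

Definition weight D := \sum_(v in D) vertex_weight v.

Lemma mem_corner i : corner G i \in corners G.
Proof. exact: imset_f. Qed.

Lemma sub_dominated D D' v : D \subset D' -> dominated D v -> dominated D' v.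
Proof.
move=> sDD' /orP[/(subsetP sDD')|/exists_inP[u uD a]]; rewrite /dominated.
  by move=> ->.
by apply/orP; right; apply/exists_inP; exists u; rewrite ?(subsetP sDD').
Qed.

Lemma dominatingP D : reflect (forall v, dominated D v) (dominating D).
Proof. exact: forallP. Qed.

Lemma dominates_interiorU K D :
  dominates_interior K D -> interior_dominating (D :|: K).
Proof.
move=> /forall_inP dom v vI; rewrite /dominated inE.
by have /orP[->|->] := dom v (introT setCP (negP vI)); rewrite ?orbT.
Qed.

Lemma weight_le D : weight D <= 2 * #|D|.
Proof.
rewrite -sum1_card big_distrr; apply: leq_sum => v _.
by rewrite /vertex_weight ltnS leq_b1.
Qed.

Lemma weightU D K : D \subset ~: corners G -> K \subset corners G ->
  weight (D :|: K) = 2 * #|D| + #|K|.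
Proof.
move=> /subsetP sD /subsetP sK; rewrite /weight.
rewrite (eq_bigl [in [predU D & K]]) => [|v]; last by rewrite !inE.
rewrite bigU /=; last first.
  by rewrite -setI_eq0; apply/eqP/setP=> v; rewrite !inE;
     apply/negP=> /andP[/sD + /sK]; rewrite inE => /negP.
rewrite -!sum1_card big_distrr; congr (_ + _); apply: eq_bigr => v.
  by move/sD; rewrite inE /vertex_weight => ->.
by move/sK; rewrite /vertex_weight => ->.
Qed.

Lemma domination_number_le D : dominating D -> domination_number G <= #|D|.
Proof.
move=> dD; rewrite /domination_number.
by case: arg_minnP => [|D' _]; [exact: dominatingT | exact].
Qed.

Lemma domination_number_witness :
  exists2 D : {set G}, dominating D & #|D| = domination_number G.
Proof.
rewrite /domination_number; case: arg_minnP => [|D dD _].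
  exact: dominatingT.
by exists D.
Qed.

Lemma corner_domination_number_witness k : k <= 3 ->
  exists2 D : {set G}, completes_corners k D
                     & #|D| = corner_domination_number G k.
Proof.
move=> k3; rewrite /corner_domination_number; case: arg_minnP => [|D dD _].
  exact: completes_cornersC.
by exists D.
Qed.

End Weight.

(** * Domination and weight under gluing *)

Section Gluing.
Variable G : graph3.
Implicit Types (D : {set glue G}) (i j : 'I_3) (x y : G).

Definition copy_part D i : {set G} := [set x | glue_pi (i, x) \in D].

Lemma glue_pi_surj (p : glue G) : exists u, p = glue_pi u.
Proof. by exists (repr p); rewrite /glue_pi reprK. Qed.

Lemma glue_pi_junction i j :
  glue_pi (i, corner G j) = glue_pi (j, corner G i).
Proof. by apply/eqP; rewrite glue_piE /glue_eq /= !eqxx orbT. Qed.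

Lemma glue_pi_corner i x :
  (glue_pi (i, x) \in corners (glue G)) = (x == corner G i).
Proof.
apply/imsetP/eqP => [[j _ /eqP]|->]; last by exists i.
rewrite glue_piE /glue_eq /=.
by case/predU1P=> [[-> ->]|/andP[/eqP-> /eqP/corner_inj->]].
Qed.

Lemma dominated_copy D i x :
  dominated (copy_part D i) x -> dominated D (glue_pi (i, x)).
Proof.
rewrite /dominated inE => /orP[->//|/exists_inP[y]]; rewrite inE => yD a.
apply/orP; right; apply/exists_inP; exists (glue_pi (i, y)) => //.
by apply/existsP; exists (i, x); apply/existsP; exists (i, y); rewrite !eqxx.
Qed.

(** Each edge of the glued graph comes from one copy, but at a junction this may be the copy of the
    other representative, hence [v]. *)
Lemma glue_dominated D u : dominated D (glue_pi u) ->
  exists2 v, glue_eq u v & dominated (copy_part D v.1) v.2.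
Proof.
case/orP=> [uD|/exists_inP[p pD /existsP[[i x] /existsP[[j y] /=]]]].
  by exists u; rewrite ?glue_eq_refl // /dominated inE -surjective_pairing uD.
case/and4P; rewrite glue_piE glue_eq_sym => uv /eqP pE /eqP ij a.
exists (i, x) => //=; apply/orP; right; apply/exists_inP; exists y => //.
by rewrite inE ij pE.
Qed.

(** A non-corner of a copy is identified with no other vertex, so its dominator lies in the same
    copy. *)
Lemma interior_dominating_copy D i :
  interior_dominating D -> interior_dominating (copy_part D i).
Proof.
move=> dom x xI.
have /dom/glue_dominated[[j y] /=] : glue_pi (i, x) \notin corners (glue G).
  by rewrite glue_pi_corner; apply: contraNneq xI => ->; apply: mem_corner.
case/predU1P=> [[-> ->] //|/andP[/eqP /= xE _]].
by rewrite xE mem_corner in xI.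
Qed.

(** A junction is interior, of weight 2, and has two representatives, both corners of weight 1. Any
    other vertex has one representative, of its own weight. *)
Lemma vertex_weight_glue (p : glue G) :
  vertex_weight p = \sum_(u | glue_pi u == p) vertex_weight u.2.
Proof.
have [[i x] ->] := glue_pi_surj p.
rewrite (bigD1 (i, x)) //= {1}/vertex_weight glue_pi_corner.
have [/imsetP[j _ ->]|xI] := boolP (x \in corners G); last first.
  rewrite big_pred0 => [|[j y]]; last first.
    rewrite glue_piE /glue_eq /=; case: eqP => //= _; apply/negP.
    by case/andP=> /andP[_ /eqP /= xE]; rewrite xE mem_corner in xI.
  rewrite /vertex_weight xI addn0; case: eqP => // xE.
  by rewrite xE mem_corner in xI.
have [<-|ij] := eqVneq i j.
  rewrite big_pred0 => [|[k y]].
    by rewrite /vertex_weight mem_corner addn0 eqxx.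
  rewrite glue_piE /glue_eq /=; case: eqP => //= ne; apply/negP.
  case/andP=> /andP[/eqP /= yE /eqP/corner_inj /= kE] _.
  by case: ne; rewrite yE kE.
rewrite (big_pred1 (j, corner G i)) => [|[k y]].
  by rewrite /vertex_weight !mem_corner inj_eq ?(eq_sym j) ?ij //;
     exact: corner_inj.
rewrite /= glue_piE /glue_eq /= (inj_eq (@corner_inj G)) !xpair_eqE eq_sym.
by move: ij; rewrite (eq_sym k j); do !case: eqP => //=; congruence.
Qed.

Lemma weight_glue D : weight D = \sum_i weight (copy_part D i).
Proof.
rewrite pair_big_dep /= /weight.
rewrite (partition_big (fun u => glue_pi u : glue G) (mem D)) /=; last first.
  by case=> i x; rewrite inE.
apply: eq_bigr => p pD; rewrite vertex_weight_glue; apply: eq_bigl => -[i x].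
by rewrite inE /=; case: eqP => [->|]; rewrite ?pD ?andbF.
Qed.

Lemma domination_number_glue :
  domination_number (glue G) <= 3 * domination_number G.
Proof.
have [D /dominatingP dD <-] := domination_number_witness G.
pose E : {set glue G} := [set glue_pi u | u in setX [set: 'I_3] D].
apply: leq_trans (domination_number_le (D := E) _) _.
  apply/dominatingP=> p; have [[i x] ->] := glue_pi_surj p.
  apply/dominated_copy/(sub_dominated _ (dD x)).
  by apply/subsetP=> y yD; rewrite inE imset_f // !inE.
by apply: leq_trans (leq_imset_card _ _) _; rewrite cardsX cardsT card_ord.
Qed.

End Gluing.

(** * The gasket graphs: base cases and induction *)

Lemma dominated_triangle (D : {set triangle}) v : dominated D v = (D != set0).
Proof.
apply/idP/set0Pn => [/orP[vD|/exists_inP[u uD _]]|[u uD]].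
- by exists v.
- by exists u.
rewrite /dominated; have [->|vu] := eqVneq v u; first by rewrite uD.
by apply/orP; right; apply/exists_inP; exists u.
Qed.

Lemma weight_glue_triangle (D : {set glue triangle}) :
  interior_dominating D -> 2 <= weight D.
Proof.
move=> dom.
(* The junction of copies [i] and [j] is interior, and its dominator lies in one of these two
   triangles. *)
have hit i j : i != j -> (copy_part D i != set0) || (copy_part D j != set0).
  move=> ij; have /dom/glue_dominated[[k y] /=] :
    glue_pi (i, corner triangle j) \notin corners (glue triangle).
    by rewrite glue_pi_corner eq_sym.
  by rewrite dominated_triangle;
    case/predU1P=> [[-> _]|/andP[/eqP/corner_inj /= -> _]] ->; rewrite ?orbT.
have pos i : copy_part D i != set0 -> 0 < weight (copy_part D i).
  by case/set0Pn=> x xD; rewrite /weight (bigD1 x).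
rewrite weight_glue !big_ord_recl big_ord0.
set a := ord0; set b := lift _ _; set c := lift _ _.
have /orP[/pos ?|/pos ?] : (copy_part D a != set0) || (copy_part D b != set0)
  by apply: hit.
all: have /orP[/pos ?|/pos ?] :
  (copy_part D b != set0) || (copy_part D c != set0) by apply: hit.
all: have /orP[/pos ?|/pos ?] :
  (copy_part D a != set0) || (copy_part D c != set0) by apply: hit.
all: lia.
Qed.

Lemma weight_sierpinski n (D : {set sierpinski n.+2}) :
  interior_dominating D -> 2 * 3 ^ n <= weight D.
Proof.
elim: n D => [|n IHn] D dom; first exact: weight_glue_triangle.
rewrite weight_glue expnS mulnCA -[X in X * _ <= _](card_ord 3) -sum_nat_const.
by apply: leq_sum => i _; apply/IHn/interior_dominating_copy.
Qed.

(* The midpoint of corners i and i+1 of the i-th copy of S_2 dominates that copy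
   except its corner i+2, which is the corner i of the copy i+2 and is dominated
   from there. *)
Lemma gamma3_le : gamma 3 <= 3.
Proof.
pose e i : glue triangle := @glue_pi triangle (i, ordS i).
pose E : {set sierpinski 3} :=
  [set @glue_pi (glue triangle) (i, e i) | i : 'I_3].
suff dE : dominating E.
  apply: leq_trans (domination_number_le dE) _.
  by apply: leq_trans (leq_imset_card _ _) _; rewrite card_ord.
(* Triangles [i] and [ordS i] of copy [i] share the chosen midpoint [e i]. *)
have hitE i j (v : triangle) : (j == i) || (j == ordS i) ->
    dominated E (@glue_pi (glue triangle) (i, glue_pi (j, v))).
  move=> ji; apply/dominated_copy/dominated_copy.
  rewrite dominated_triangle; apply/set0Pn.
  have mE : @glue_pi (glue triangle) (i, e i) \in E by exact: imset_f.
  case/orP: ji => /eqP->; first by exists (ordS i); rewrite !inE.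
  by exists i; rewrite !inE (@glue_pi_junction triangle (ordS i) i).
apply/dominatingP=> p; have [[i q] ->] := glue_pi_surj p.
have [[j v] ->] := glue_pi_surj q.
have [/hitE//|] := boolP ((j == i) || (j == ordS i)).
rewrite negb_or => /andP[ji jSi].
(* In the third triangle, a vertex [v] other than [j] is also a vertex of triangle [v], which is
   hit. *)
have [/hitE hv|] := boolP ((v == i) || (v == ordS i)).
  by rewrite (@glue_pi_junction triangle j v).
rewrite negb_or => /andP[vi vSi].
have -> : v = j.
  apply/val_inj; move: ji jSi vi vSi; rewrite -!(inj_eq val_inj) /=.
  by case: i j v => [[|[|[|//]]] ?] [[|[|[|//]]] ?] [[|[|[|//]]] ?].
(* Seen from copy [j], this corner lies in triangle [i], and [i = ordS j]. *)
rewrite (@glue_pi_junction (glue triangle) i j); apply: hitE.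
apply/orP; right; move: ji jSi {vi vSi}; rewrite -!(inj_eq val_inj) /=.
by case: i j => [[|[|[|//]]] ?] [[|[|[|//]]] ?].
Qed.

Lemma gamma_sierpinski n : gamma n.+3 = 3 ^ n.+1.
Proof.
apply/eqP; rewrite eqn_leq; apply/andP; split.
  elim: n => [|n IHn]; first exact: gamma3_le.
  rewrite expnS; apply: leq_trans (domination_number_glue _) _.
  by rewrite leq_mul2l.
(* Lower bound: the weight of [D] is at most [2 * #|D|], and the factor 2 cancels. *)
have [D /dominatingP dD cD] := domination_number_witness (sierpinski n.+3).
rewrite -(leq_pmul2l (isT : 0 < 2)) /gamma -cD.
by apply: leq_trans (weight_le D); apply: weight_sierpinski => v _; apply: dD.
Qed.

(** Adjoining the [k] corners of [K] to an optimal [D] adds only [k] to its weight. *)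
Lemma gammak_sierpinski n k : k <= 3 -> 2 * 3 ^ n <= 2 * gammak n.+2 k + k.
Proof.
move=> k3; rewrite /gammak.
have [D /andP[sD /existsP[K /and3P[sK /eqP cK dK]]] <-] :=
  corner_domination_number_witness (sierpinski n.+2) k3.
rewrite -[X in _ + X]cK -weightU //.
exact/weight_sierpinski/dominates_interiorU.
Qed.

Theorem theorem7 (n : nat) (hn : 4 <= n) :
  [/\ gamma n = 3 * gamma (n - 1),
      forall k : nat, k = 0 \/ k = 1 -> gammak n k >= gamma n
    & forall k : nat, k = 2 \/ k = 3 -> gammak n k >= gamma n - 1].
Proof.
case: n hn => [|[|[|[|n]]]] // _; rewrite subn1 /= !gamma_sierpinski.
split=> [|k kE|k kE]; first by rewrite -expnS.
all: have /(@gammak_sierpinski n.+2) : k <= 3 by case: kE => ->.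
(* From [2 * b <= 2 * a + k], integrality loses only the floor of [k / 2]: 0 for [k] at most 1, and
   1 for [k] equal to 2 or 3. *)
all: by set a := gammak _ _; set b := 3 ^ _; case: kE => ->; lia.
Qed.
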